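(* Let $\mathcal{D}$ be an $[n,k,d]_q$ linear code with $d<n$, let $M(\mathcal{D})$ be the binary matrix obtained from $\mathcal{D}$ by the Kautz-Singleton construction, and let $\mathcal{C}$ be the binary code with parity-check matrix $M(\mathcal{D})$. Then $$d_{\min}(\mathcal{C})\ge \left\lfloor\frac{n-1}{n-d}\right\rfloor+2.$$
   Context: An $[n,k,d]_q$ code is a $k$-dimensional linear subspace of $\mathbb{F}_q^n$ with minimum distance $d$ ($k\ge 1$). Kautz-Singleton construction: order the elements of $\mathbb{F}_q$ as $\alpha_1,\dots,\alpha_q$ and let $\mathbf{e}_i$ be the $i$th standard basis column vector of length $q$. The binary matrix $M(\mathcal{D})$ is formed by listing all codewords of $\mathcal{D}$ as the columns of a matrix and then replacing each symbol $\alpha_i$ with the column vector $\mathbf{e}_i$; thus $M(\mathcal{D})$ is $nq\times q^k$. The binary code with parity-check matrix $H$ (with $N$ columns) is $\{\mathbf{x}\in\mathbb{F}_2^N : H\mathbf{x}^T=\mathbf{0}\}$. The minimum distance $d_{\min}$ of a linear code is the minimum Hamming weight of a nonzero codeword, taken to be $\infty$ if the only codeword is $\mathbf{0}$. *)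

(* Defs.v *)
From HB Require Import structures.
From mathcomp Require Import all_boot all_order all_algebra.
From mathcomp Require Import constructive_ereal.

Set Implicit Arguments.
Unset Strict Implicit.
Unset Printing Implicit Defensive.

Import Order.TTheory GRing.Theory Num.Theory.
Local Open Scope ring_scope.

Definition hamming_weight (F : finFieldType) (n : nat) (x : 'rV[F]_n) : nat :=
  #|[set i : 'I_n | x 0 i != 0]|.

(* Valued in the extended integers, so that the zero code gets +oo. *)
Definition min_dist (F : finFieldType) (n : nat) (C : {vspace 'rV[F]_n}) :
    \bar int :=
  \big[Order.min/+oo%E]_(x in C | x != 0) ((hamming_weight x)%:Z)%:E.

Definition is_linear_code (F : finFieldType) (q n k d : nat)
    (D : {vspace 'rV[F]_n}) : Prop :=
  [/\ #|F| = q, (1 <= k)%N, \dim D = k & min_dist D = (d%:Z)%:E].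

Definition lists_codewords (F : finFieldType) (n N : nat)
    (D : {vspace 'rV[F]_n}) (w : 'I_N -> 'rV[F]_n) : Prop :=
  injective w /\ (forall c : 'rV[F]_n, c \in D <-> exists j, w j = c).

(* The standard basis vector e_i, where s = alpha i. *)
Definition one_hot (F : finFieldType) (q : nat) (alpha : 'I_q -> F) (s : F) :
    'rV['F_2]_q :=
  \row_(i < q) (alpha i == s)%:R.

(* [mxvec] concatenates the rows of an n x q matrix, so column j is the
   vertical concatenation of the n blocks of length q encoding the successive
   symbols of the codeword w j. *)
Definition kautz_singleton (F : finFieldType) (q n N : nat)
    (alpha : 'I_q -> F) (w : 'I_N -> 'rV[F]_n) : 'M['F_2]_(n * q, N) :=
  \matrix_(r < n * q, j < N)
    mxvec (\matrix_(i < n) one_hot alpha (w j 0 i)) 0 r.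

Definition parity_check_code (m N : nat) (H : 'M['F_2]_(m, N)) :
    {vspace 'rV['F_2]_N} :=
  lker (linfun (mulmx H \o @trmx 'F_2 1 N)).

Lemma mem_parity_check_code (m N : nat) (H : 'M['F_2]_(m, N))
    (x : 'rV['F_2]_N) :
  (x \in parity_check_code H) = (H *m x^T == 0).
Proof. by rewrite memv_ker lfunE. Qed.

Lemma kautz_singletonE (F : finFieldType) (q n N : nat)
    (alpha : 'I_q -> F) (w : 'I_N -> 'rV[F]_n) (i : 'I_n) (a : 'I_q)
    (j : 'I_N) :
  kautz_singleton alpha w (mxvec_index i a) j = (alpha a == w j 0 i)%:R.
Proof. by rewrite mxE mxvecE !mxE. Qed.

(* Main.v *)
(* Let x be a nonzero codeword, S its support and j0 in S. Each of the n
   positions of the codeword w j0 is shared with some w j, j in S \ {j0};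
   distinct codewords of D agree in at most n - d positions, so
   n <= (#|S| - 1) (n - d). *)

Require Import Defs.
From HB Require Import structures.
From mathcomp Require Import all_boot all_order all_algebra.
From mathcomp Require Import constructive_ereal.

Set Implicit Arguments.
Unset Strict Implicit.
Unset Printing Implicit Defensive.

Import Order.TTheory GRing.Theory Num.Theory.
Local Open Scope ring_scope.

Lemma min_dist_le (F : finFieldType) (n : nat) (C : {vspace 'rV[F]_n})
    (x : 'rV[F]_n) :
  x \in C -> x != 0 -> (min_dist C <= ((hamming_weight x)%:Z)%:E)%E.
Proof. by move=> Cx x0; apply: bigmin_le_cond; rewrite Cx. Qed.

Lemma le_min_dist (F : finFieldType) (n m : nat) (C : {vspace 'rV[F]_n}) :
  (forall x, x \in C -> x != 0 -> (m <= hamming_weight x)%N) ->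
  ((m%:Z)%:E <= min_dist C)%E.
Proof.
(* The default value [+oo] of the minimum must satisfy the bound too; this case settles the zero
   code. *)
move=> mP; apply: le_bigmin => [|x /andP[Cx x0]]; first by rewrite leey.
by rewrite lee_fin lez_nat mP.
Qed.

Lemma leq_card_bigcup (I T : finType) (P : {pred I}) (A : I -> {set T}) :
  (#|\bigcup_(i in P) A i| <= \sum_(i in P) #|A i|)%N.
Proof.
elim/big_rec2: _ => [|i m B _ leB]; first by rewrite cards0.
by rewrite (leq_trans (leq_card_setU _ _)) // leq_add2l.
Qed.

Lemma card_agree_hamming_weight (F : finFieldType) (n : nat) (u v : 'rV[F]_n) :
  #|[set i | u 0 i == v 0 i]| = (n - hamming_weight (u - v))%N.
Proof.
have -> : [set i | u 0 i == v 0 i] = ~: [set i | (u - v) 0 i != 0].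
  by apply/setP => i; rewrite !inE !mxE subr_eq0 negbK.
by rewrite cardsCs setCK card_ord.
Qed.

(* Row (i, u_i) of the parity check, with u = w j0, would otherwise meet the
   support of x in column j0 alone. *)
Lemma kautz_singleton_cover (F : finFieldType) (q n N : nat) (alpha : 'I_q -> F)
    (w : 'I_N -> 'rV[F]_n) (x : 'rV['F_2]_N) (j0 : 'I_N) (i : 'I_n) :
  bijective alpha -> x \in parity_check_code (kautz_singleton alpha w) ->
  x 0 j0 != 0 -> exists2 j, (x 0 j != 0) && (j != j0) & w j 0 i = w j0 0 i.
Proof.
move=> [beta _ betaK]; rewrite mem_parity_check_code => /eqP Hx xj0.
have [/existsP[j /andP[jP /eqP wj]]|noj] := boolP
  [exists j, ((x 0 j != 0) && (j != j0)) && (w j 0 i == w j0 0 i)].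
  by exists j.
case/negP: xj0; apply/eqP.
(* [beta] turns the symbol of [w j0] at position [i] into its index under [alpha]. The chosen row
   thus has a 1 exactly in the columns whose codeword agrees with [w j0] at [i]. *)
move/matrixP/(_ (mxvec_index i (beta (w j0 0 i))) 0): Hx.
rewrite !mxE (bigD1 j0) //= kautz_singletonE betaK eqxx mul1r mxE.
rewrite big1 ?addr0 // => j jj0; rewrite kautz_singletonE betaK mxE.
move: noj; rewrite negb_exists => /forallP/(_ j); rewrite jj0 andbT.
by rewrite negb_and negbK [w j0 0 i == _]eq_sym => /orP[/eqP->|/negbTE->]; rewrite ?mulr0 ?mul0r.
Qed.

Theorem corollary3p24 (F : finFieldType) (q n k d : nat)
    (D : {vspace 'rV[F]_n})
    (hD : is_linear_code q k d D)
    (hdn : (d < n)%N)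
    (alpha : 'I_q -> F) (halpha : bijective alpha)
    (w : 'I_(q ^ k) -> 'rV[F]_n) (hw : lists_codewords D w) :
  ((((n - 1) %/ (n - d) + 2)%N%:Z)%:E
     <= min_dist (parity_check_code (kautz_singleton alpha w)))%E.
Proof.
case: hD => _ _ _ dD; have [w_inj wD] := hw.
apply: le_min_dist => x Cx /rV0Pn[j0 xj0].
pose S := [set j | x 0 j != 0].
have Sj0 : j0 \in S by rewrite inE.
pose A j := [set i | w j 0 i == w j0 0 i].
(* By linearity and injectivity of [w], the difference [w j - w j0] is a nonzero codeword of [D],
   hence of weight at least [d]. *)
have leA j : j \in S :\ j0 -> (#|A j| <= n - d)%N.
  rewrite in_setD1 => /andP[jj0 _]; rewrite card_agree_hamming_weight leq_sub2l //.
  rewrite -lez_nat -lee_fin -dD; apply: min_dist_le.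
    by apply: rpredB; apply/wD; [exists j | exists j0].
  by rewrite subr_eq0 (inj_eq w_inj).
have len : (n <= #|S :\ j0| * (n - d))%N.
  rewrite -sum_nat_const -[X in (X <= _)%N]card_ord.
  (* Union bound: the sets [A j] for [j] in [S :\ j0] cover all [n] positions, so their sizes sum to
     at least [n]. *)
  apply: leq_trans _ (leq_sum _ leA).
  apply: leq_trans _ (leq_card_bigcup _ _).
  apply: subset_leq_card; apply/subsetP => i _; apply/bigcupP.
  have [j jP wj] := kautz_singleton_cover i halpha Cx xj0.
  by exists j; rewrite !inE ?wj // andbC.
(* One unit of the summand 2 accounts for [j0]; the other makes the inequality strict. Since [n - d]
   is positive, clearing the floor leaves [n - 1 < #|S :\ j0| * (n - d)], which is [len] as [n] is
   positive. *)
rewrite /hamming_weight -/S (cardsD1 j0) Sj0 addn2 add1n ltnS.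
by rewrite ltn_divLR ?subn_gt0 // subn1 prednK // (leq_ltn_trans _ hdn).
Qed.
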